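(* Consider the weight-adjusted flux-differencing modal discretization $$\frac{d\tilde u^{(\kappa,e)}}{dt}=\big(\tilde M^{(\kappa)}\big)^{-1}V^{\mathrm T}r^{(\kappa,e)},\qquad \kappa\in\{1,\dots,N_e\},\ e\in\{1,\dots,N_c\},$$ with $r^{(\kappa,e)}$ as defined in the context. Assume: (i) the SBP operators on the reference element are diagonal-norm, all share the same positive-definite matrix $W$, and have boundary operators of the form $E^{(l)}=\sum_{\zeta}\hat n_l^{(\zeta)}(R^{(\zeta)})^{\mathrm T}B^{(\zeta)}R^{(\zeta)}$; the Jacobian determinant $\mathcal J^{(\kappa)}$ of each mapping (computed exactly or approximated by an interpolant) is positive on $\hat\Omega$; each two-point flux $f_m^\#$ is symmetric in its two arguments and consistent ($f_m^\#(U,U)=f_m(U)$ for all $U\in\Upsilon$); the directional numerical flux $f^*$ is consistent ($f^*(U,U,n)=\sum_mn_mf_m(U)$) and conservative ($f^*(U^-,U^+,n)=-f^*(U^+,U^-,-n)$); (ii) the mesh is conforming in the following sense: for each pair of element indices $\kappa,\nu\in\{1,\dots,N_e\}$ with $\kappa\neq\nu$ such that $\partial\Omega^{(\kappa)}\cap\partial\Omega^{(\nu)}\neq\emptyset$, there exists a unique pair of facet indices $\zeta,\eta\in\{1,\dots,N_f\}$ such that $\Gamma^{(\kappa,\zeta)}=\Gamma^{(\nu,\eta)}$; furthermore, for every $i\in\{1,\dots,N_{q_f}^{(\zeta)}\}$ there exists a unique $j\in\{1,\dots,N_{q_f}^{(\eta)}\}$ for which $n_i^{(\kappa,\zeta)}=-n_j^{(\nu,\eta)}$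 and $\omega^{(\zeta,i)}\mathcal J_i^{(\kappa,\zeta)}=\omega^{(\eta,j)}\mathcal J_j^{(\nu,\eta)}$, where the normals are computed from the (exact or approximate) volume metric terms as in the context; (iii) for every $\kappa$, $\mathcal J^{(\kappa)}$ (exact or approximate) is a polynomial of total degree at most $p$ on $\hat\Omega$, and the quadrature rule with nodes $\xi^{(i)}$ and weights $W_{ii}$ integrates over $\hat\Omega$ exactly all polynomials of total degree at most $\tau$, for some $\tau\ge 2p$. Then the discretization is discretely conservative: for every $e\in\{1,\dots,N_c\}$, $$\frac{d}{dt}\sum_{\kappa=1}^{N_e}\mathbf 1^{\mathrm T}WJ^{(\kappa)}u^{(\kappa,e)}(t)=-\sum_{\Gamma^{(\kappa,\zeta)}\subset\partial\Omega}\mathbf 1^{\mathrm T}B^{(\zeta)}J^{(\kappa,\zeta)}f^{( *,\kappa,\zeta,e)}(t),$$ where the sum on the right is over all element facets lying on $\partial\Omega$.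
   Context: Conservation law. $d\in\{2,3\}$, $N_c\in\mathbb N$, $\Upsilon\subset\mathbb R^{N_c}$ is the set of admissible states and $f_m:\Upsilon\to\mathbb R^{N_c}$, $m=1,\dots,d$, are the flux components of the hyperbolic system $\partial_tu+\sum_m\partial_{x_m}f_m(u)=0$ on a domain $\Omega\subset\mathbb R^d$. The system is endowed with a strictly convex entropy function $\mathcal S:\Upsilon\to\mathbb R$ (positive-definite Hessian) and an entropy flux $\mathcal F:\Upsilon\to\mathbb R^d$ satisfying $(\nabla\mathcal F_m)^{\mathrm T}=(\nabla\mathcal S)^{\mathrm T}\nabla f_m$ for all $m$; $\mathcal W:=\nabla\mathcal S$ is the map to entropy variables and $\mathcal U:\mathcal W(\Upsilon)\to\Upsilon$ its inverse. $f_m^\#:\Upsilon\times\Upsilon\to\mathbb R^{N_c}$ are two-point fluxes and $f^*:\Upsilon\times\Upsilon\times\mathbb S^{d-1}\to\mathbb R^{N_c}$ is a directional numerical flux. Reference element and SBP operators. $\hat\Omega\subset\mathbb R^d$ is the reference triangle or tetrahedron, with flat facets $\hat\Gamma^{(\zeta)}$, $\zeta\in\{1,\dots,N_f\}$, and constant outward unit normals $\hat n^{(\zeta)}$. Volume nodes $\xi^{(1)},\dots,\xi^{(N_q)}\in\hat\Omega$ are distinct; facet nodes $\xi^{(\zeta,i)}\in\hat\Gamma^{(\zeta)}$ have weights $\omega^{(\zeta,i)}\ge0$, $i\in\{1,\dots,N^{(\zeta)}_{q_f}\}$, and $B^{(\zeta)}:=\operatorname{diag}_i(\omega^{(\zeta,i)})$.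 $D^{(l)}=W^{-1}Q^{(l)}\in\mathbb R^{N_q\times N_q}$, $l=1,\dots,d$, are nodal SBP operators of degree $q$: $D^{(l)}$ exactly differentiates (with respect to $\xi_l$, at the nodes) polynomials of total degree at most $q$; $W$ is symmetric positive definite; $Q^{(l)}+(Q^{(l)})^{\mathrm T}=E^{(l)}$, where $u^{\mathrm T}E^{(l)}v=\int_{\partial\hat\Omega}uv\,\hat n_l\,d\hat s$ for nodal vectors of polynomials of degree at most some $r\ge q$. ''Diagonal-norm'' means $W$ is diagonal. $R^{(\zeta)}\in\mathbb R^{N^{(\zeta)}_{q_f}\times N_q}$ maps nodal values of polynomials of total degree at most $r^{(\zeta)}$ ($r^{(\zeta)}\ge p$) exactly to their values at the nodes of facet $\zeta$. $S^{(l)}:=Q^{(l)}-\frac12E^{(l)}$ is skew-symmetric. Geometry. The mesh consists of $N_e$ closed elements $\Omega^{(\kappa)}$ with non-overlapping interiors covering $\bar\Omega$; $\Omega^{(\kappa)}$ is the image of $\hat\Omega$ under a bijective polynomial mapping $X^{(\kappa)}$, and $\Gamma^{(\kappa,\zeta)}:=X^{(\kappa)}(\hat\Gamma^{(\zeta)})$. $\mathcal J^{(\kappa)}:\hat\Omega\to\mathbb R$ is the determinant of $\nabla_\xi X^{(\kappa)}$ or a polynomial interpolant of it; $J^{(\kappa)}:=\operatorname{diag}_i(\mathcal J^{(\kappa)}(\xi^{(i)}))$. $G^{(\kappa)}:\hat\Omega\to\mathbb R^{d\times d}$ is the adjugate of $\nabla_\xi X^{(\kappa)}$ or an approximation of it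 (metric terms). Facet quantities are computed from it: $\mathcal J^{(\kappa,\zeta)}_i:=\|G^{(\kappa)}(\xi^{(\zeta,i)})^{\mathrm T}\hat n^{(\zeta)}\|$ (nonzero), $J^{(\kappa,\zeta)}:=\operatorname{diag}_i(\mathcal J_i^{(\kappa,\zeta)})$, and unit normals $n^{(\kappa,\zeta)}_i:=G^{(\kappa)}(\xi^{(\zeta,i)})^{\mathrm T}\hat n^{(\zeta)}/\mathcal J_i^{(\kappa,\zeta)}$. Averages: $\{\!\{G^{(\kappa)}_{lm}\}\!\}_{ij}:=\frac12\big(G^{(\kappa)}_{lm}(\xi^{(i)})+G^{(\kappa)}_{lm}(\xi^{(j)})\big)$ (size $N_q\times N_q$) and $\{\!\{\mathcal J^{(\kappa,\zeta)}n_m^{(\kappa,\zeta)}\}\!\}_{ij}:=\frac12\big[G^{(\kappa)}(\xi^{(i)})^{\mathrm T}\hat n^{(\zeta)}+G^{(\kappa)}(\xi^{(\zeta,j)})^{\mathrm T}\hat n^{(\zeta)}\big]_m$ (size $N_q\times N^{(\zeta)}_{q_f}$). Modal expansion. $\{\phi^{(i)}\}$ is a basis of the polynomials of total degree at most $p$ on $\hat\Omega$, $p\le q$; $V_{ij}:=\phi^{(j)}(\xi^{(i)})$; $M:=V^{\mathrm T}WV$ is invertible. $\tilde u^{(\kappa,e)}(t)$ is the vector of modal coefficients of the $e$-th solution variable on element $\kappa$, $u^{(\kappa,e)}:=V\tilde u^{(\kappa,e)}$, and $u_i^{(\kappa)}:=(u_i^{(\kappa,1)},\dots,u_i^{(\kappa,N_c)})$.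 The weight-adjusted mass matrix $\tilde M^{(\kappa)}$ is defined by $(\tilde M^{(\kappa)})^{-1}:=M^{-1}V^{\mathrm T}W(J^{(\kappa)})^{-1}VM^{-1}$. Entropy projection. $\tilde w^{(\kappa,e)}:=(\tilde M^{(\kappa)})^{-1}V^{\mathrm T}WJ^{(\kappa)}\big[\mathcal W_e(u_1^{(\kappa)}),\dots,\mathcal W_e(u_{N_q}^{(\kappa)})\big]^{\mathrm T}$, $w^{(\kappa,e)}:=V\tilde w^{(\kappa,e)}$, $w_i^{(\kappa)}:=(w_i^{(\kappa,e)})_{e}$, $w_i^{(\kappa,\zeta)}:=([R^{(\zeta)}w^{(\kappa,e)}]_i)_{e}$. $w_i^{(\kappa,\zeta,+)}$ denotes the exterior value of the entropy variables: on a facet $\Gamma^{(\kappa,\zeta)}=\Gamma^{(\nu,\eta)}$ shared with another element it is $w_j^{(\nu,\eta)}$, with $j$ the node corresponding to $i$, and on $\partial\Omega$ it is given by the boundary conditions. All states are assumed admissible: $u_i^{(\kappa)}\in\Upsilon$ and $w_i^{(\kappa)},w_i^{(\kappa,\zeta)},w_i^{(\kappa,\zeta,+)}\in\mathcal W(\Upsilon)$. Fluxes. $F^{(\kappa,m,e)}_{ij}:=[f_m^\#(\mathcal U(w_i^{(\kappa)}),\mathcal U(w_j^{(\kappa)}))]_e$, $F^{(\kappa,\zeta,m,e)}_{ij}:=[f_m^\#(\mathcal U(w_i^{(\kappa)}),\mathcal U(w_j^{(\kappa,\zeta)}))]_e$ (size $N_q\times N_{q_f}^{(\zeta)}$), $f_i^{(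 *,\kappa,\zeta,e)}:=[f^*(\mathcal U(w_i^{(\kappa,\zeta)}),\mathcal U(w_i^{(\kappa,\zeta,+)}),n_i^{(\kappa,\zeta)})]_e$. Right-hand side of the scheme. With $\odot$ the Hadamard product and $\mathbf 1$ all-ones vectors of appropriate length, $$r^{(\kappa,e)}:=-\sum_{l=1}^d\Big(2S^{(l)}\odot\sum_{m=1}^d\{\!\{G^{(\kappa)}_{lm}\}\!\}\odot F^{(\kappa,m,e)}\Big)\mathbf 1-\sum_{\zeta=1}^{N_f}\Big(C^{(\kappa,\zeta,e)}\mathbf 1+(R^{(\zeta)})^{\mathrm T}\big(B^{(\zeta)}J^{(\kappa,\zeta)}f^{( *,\kappa,\zeta,e)}-(C^{(\kappa,\zeta,e)})^{\mathrm T}\mathbf 1\big)\Big),$$ $$C^{(\kappa,\zeta,e)}:=\big((R^{(\zeta)})^{\mathrm T}B^{(\zeta)}\big)\odot\sum_{m=1}^d\{\!\{\mathcal J^{(\kappa,\zeta)}n_m^{(\kappa,\zeta)}\}\!\}\odot F^{(\kappa,\zeta,m,e)}.$$ *)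

(* Defs.v *)
From HB Require Import structures.
From mathcomp Require Import all_boot all_order all_algebra.
From mathcomp Require Import all_classical all_reals all_analysis.
From mathcomp Require Import (canonicals, coercions) mpoly.

Set Implicit Arguments.
Unset Strict Implicit.
Unset Printing Implicit Defensive.
Import Order.TTheory GRing.Theory Num.Theory numFieldNormedType.Exports.
Local Open Scope classical_set_scope.
Local Open Scope ring_scope.

(* Points of R^d, states and gradients are row vectors; vectors of nodal values
   and of modal coefficients are column vectors. *)

Definition ones {R : realType} (n : nat) : 'cV[R]_n := const_mx 1.

Definition hadamard {R : realType} (m n : nat) (A B : 'M[R]_(m, n)) :
  'M[R]_(m, n) := map2_mx *%R A B.

Definition dot {R : realType} (n : nat) (x y : 'rV[R]_n) : R :=
  \sum_i x 0 i * y 0 i.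

(* The library norm of ['rV[R]_n] is the sup norm, hence this definition. *)
Definition enorm {R : realType} (n : nat) (x : 'rV[R]_n) : R :=
  Num.sqrt (dot x x).

Definition posdef {R : realType} (n : nat) (A : 'M[R]_n) : Prop :=
  A^T = A /\ forall x : 'cV[R]_n, x != 0 -> 0 < (x^T *m A *m x) 0 0.

Definition partial {R : realType} (n : nat) (i : 'I_n) (f : 'rV[R]_n -> R)
  (x : 'rV[R]_n) : R := 'D_(delta_mx 0 i) f x.

Definition boundary {R : realType} (n : nat) (A : set 'rV[R]_n) :
  set 'rV[R]_n := closure A `\` interior A.

(* Polynomial functions of total degree at most [k]: [msize] is one plus the
   total degree, and is 0 for the zero polynomial. *)
Definition polyfun {R : realType} (d k : nat) (f : 'rV[R]_d -> R) : Prop :=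
  exists2 g : mpoly.mpoly d R,
    (mpoly.msize g <= k.+1)%N & forall x, f x = mpoly.meval (fun i => x 0 i) g.

(* Integral over R^n as an iterated Lebesgue integral; it is only applied to
   polynomials truncated to a simplex, where it agrees with the integral
   against n-dimensional Lebesgue measure by Fubini's theorem. *)
Fixpoint iter_integral {R : realType} (n : nat) : ('rV[R]_n -> R) -> R :=
  match n with
  | 0 => fun f => f 0
  | n'.+1 => fun f =>
      \int[@lebesgue_measure R]_(x in setT)
        @iter_integral R n' (fun y => f (row_mx (x%:M : 'M[R]_1) y))
  end.

Definition integral_over {R : realType} (n : nat) (A : set 'rV[R]_n)
  (f : 'rV[R]_n -> R) : R := iter_integral (fun x => f x * \1_A x).

Definition simplex {R : realType} (d : nat) (v : 'I_d.+1 -> 'rV[R]_d) :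
  set 'rV[R]_d :=
  [set x | exists a : 'I_d.+1 -> R,
     [/\ forall i, 0 <= a i, \sum_i a i = 1 & x = \sum_i a i *: v i]].

(* The facet opposite to the vertex [v z]. *)
Definition facet {R : realType} (d : nat) (v : 'I_d.+1 -> 'rV[R]_d)
  (z : 'I_d.+1) : set 'rV[R]_d :=
  [set x | exists a : 'I_d.+1 -> R,
     [/\ forall i, 0 <= a i, \sum_i a i = 1, a z = 0
       & x = \sum_i a i *: v i]].

Definition unit_simplex {R : realType} (n : nat) : set 'rV[R]_n :=
  [set t | (forall i, 0 <= t 0 i) /\ \sum_i t 0 i <= 1].

(* Surface integral over a facet of an (n+1)-dimensional simplex, through the
   affine parametrization [t |-> w_0 + \sum_i t_i (w_{i+1} - w_0)] of the facet
   with vertices [w_0, ..., w_n] by the unit simplex of R^n; the area element is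
   the square root of the Gram determinant of the edges. *)
Definition facet_integral {R : realType} (n : nat)
    (v : 'I_n.+2 -> 'rV[R]_n.+1) (z : 'I_n.+2) (f : 'rV[R]_n.+1 -> R) : R :=
  let w (i : 'I_n.+1) := v (lift z i) in
  let edge (i : 'I_n) := w (lift ord0 i) - w ord0 in
  Num.sqrt (\det (\matrix_(i, j) dot (edge i) (edge j))) *
  integral_over (@unit_simplex R n)
    (fun t => f (w ord0 + \sum_i t 0 i *: edge i)).

(* The spatial dimension is [n.+1] throughout, so that a simplex has [n.+2]
   facets, each with [n.+1] vertices. *)

Record reference (R : realType) (n : nat) := Reference {
  vertex : 'I_n.+2 -> 'rV[R]_n.+1;
  nhat : 'I_n.+2 -> 'rV[R]_n.+1;
  Nq : nat;
  vnode : 'I_Nq -> 'rV[R]_n.+1;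
  Nqf : 'I_n.+2 -> nat;
  fnode : forall z, 'I_(Nqf z) -> 'rV[R]_n.+1;
  fweight : forall z, 'I_(Nqf z) -> R;
  Wmx : 'M[R]_Nq;
  Qmx : 'I_n.+1 -> 'M[R]_Nq;
  Emx : 'I_n.+1 -> 'M[R]_Nq;
  Rmx : forall z, 'M[R]_(Nqf z, Nq);
  Np : nat;
  phi : 'I_Np -> 'rV[R]_n.+1 -> R }.

Section ReferenceElement.
Context {R : realType} {n : nat} (X : reference R n).

Definition ref_elem : set 'rV[R]_n.+1 := simplex (vertex X).
Definition ref_facet (z : 'I_n.+2) : set 'rV[R]_n.+1 := facet (vertex X) z.

Definition nodal (f : 'rV[R]_n.+1 -> R) : 'cV[R]_(Nq X) :=
  \col_i f (vnode i).

Definition Bmx (z : 'I_n.+2) : 'M[R]_(Nqf X z) :=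
  diag_mx (\row_i fweight i).

Definition Dmx (l : 'I_n.+1) : 'M[R]_(Nq X) := invmx (Wmx X) *m Qmx X l.

Definition Smx (l : 'I_n.+1) : 'M[R]_(Nq X) :=
  Qmx X l - 2^-1 *: Emx X l.

Definition Vmx : 'M[R]_(Nq X, Np X) := \matrix_(i, j) phi j (vnode i).

Definition Mmx : 'M[R]_(Np X) := Vmx^T *m Wmx X *m Vmx.

Record reference_element : Prop := {
  vertices_nondegenerate :
    (\matrix_(i < n.+1) (vertex X (lift ord0 i) - vertex X ord0)) \in unitmx;
  nhat_unit : forall z, enorm (nhat X z) = 1;
  nhat_orthogonal : forall z x y, ref_facet z x -> ref_facet z y ->
    dot (nhat X z) (y - x) = 0;
  nhat_outward : forall z x y, ref_facet z x -> ref_elem y ->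
    dot (nhat X z) (y - x) <= 0;
  vnode_in : forall i, ref_elem (vnode (r:=X) i);
  vnode_distinct : injective (@vnode _ _ X);
  fnode_in : forall z i, ref_facet z (fnode (r:=X) (z:=z) i);
  fweight_ge0 : forall z i, 0 <= fweight (r:=X) (z:=z) i }.

(* SBP operators of degree [q] sharing the norm matrix [Wmx X]; [p] is the
   degree of the modal expansion. *)
Record sbp_operators (p q : nat) : Prop := {
  Wmx_posdef : posdef (Wmx X);
  Dmx_exact : forall l f, polyfun q f ->
    Dmx l *m nodal f = nodal (partial l f);
  Qmx_sbp : forall l, Qmx X l + (Qmx X l)^T = Emx X l;
  Emx_exact : forall l, exists2 r, (q <= r)%N &
    forall f g, polyfun r f -> polyfun r g ->
      ((nodal f)^T *m Emx X l *m nodal g) 0 0 =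
      \sum_z nhat X z 0 l *
        facet_integral (vertex X) z (fun x => f x * g x);
  Rmx_exact : forall z, exists2 r, (p <= r)%N &
    forall f, polyfun r f ->
      Rmx X z *m nodal f = \col_i f (fnode (r:=X) (z:=z) i) }.

Record modal_basis (p : nat) : Prop := {
  phi_poly : forall j, polyfun p (phi (r:=X) j);
  phi_basis : forall f, polyfun p f ->
    exists! c : 'cV[R]_(Np X), forall x, f x = \sum_j c j 0 * phi j x;
  Mmx_unit : Mmx \in unitmx }.

Definition E_decomposition : Prop :=
  forall l, Emx X l =
    \sum_z nhat X z 0 l *: ((Rmx X z)^T *m Bmx z *m Rmx X z).

Definition quadrature_exact (tau : nat) : Prop :=
  forall f, polyfun tau f ->
    \sum_i Wmx X i i * f (vnode i) = integral_over ref_elem f.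

End ReferenceElement.

(* [jacdet k] and [metric k] are the (exact or approximate) Jacobian determinant
   and metric terms; [metric k x l m] is the entry $G_{lm}$, so that
   $G^T \hat n$ is the row vector [nhat *m G]. *)
Record mesh (R : realType) (n : nat) := Mesh {
  Ne : nat;
  Omega : set 'rV[R]_n.+1;
  mapX : 'I_Ne -> 'rV[R]_n.+1 -> 'rV[R]_n.+1;
  jacdet : 'I_Ne -> 'rV[R]_n.+1 -> R;
  metric : 'I_Ne -> 'rV[R]_n.+1 -> 'M[R]_n.+1 }.

Section Geometry.
Context {R : realType} {n : nat} (X : reference R n) (T : mesh R n).

Definition elem (k : 'I_(Ne T)) : set 'rV[R]_n.+1 := mapX k @` ref_elem X.

Definition efacet (k : 'I_(Ne T)) (z : 'I_n.+2) : set 'rV[R]_n.+1 :=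
  mapX k @` ref_facet X z.

(* The boundary of a curved simplex: the image of the boundary of the reference
   simplex. *)
Definition elem_boundary (k : 'I_(Ne T)) : set 'rV[R]_n.+1 :=
  \bigcup_z efacet k z.

Definition on_domain_boundary (k : 'I_(Ne T)) (z : 'I_n.+2) : Prop :=
  efacet k z `<=` boundary (Omega T).

Definition mapping_jacobian (k : 'I_(Ne T)) (x : 'rV[R]_n.+1) : 'M[R]_n.+1 :=
  \matrix_(m, l) partial l (fun y => mapX k y 0 m) x.

Definition exact_jacdet (k : 'I_(Ne T)) : Prop :=
  forall x, ref_elem X x -> jacdet k x = \det (mapping_jacobian k x).

(* Interpolation at nodes that are unisolvent for the polynomials of total
   degree at most [r]. *)
Definition interpolated_jacdet (k : 'I_(Ne T)) : Prop :=
  exists (r N : nat) (node : 'I_N -> 'rV[R]_n.+1),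
    [/\ forall i, ref_elem X (node i),
        forall f, polyfun r f -> (forall i, f (node i) = 0) ->
          forall x, f x = 0,
        polyfun r (jacdet k)
      & forall i, jacdet k (node i) = \det (mapping_jacobian k (node i))].

Definition Jmx (k : 'I_(Ne T)) : 'M[R]_(Nq X) :=
  diag_mx (\row_i jacdet k (vnode i)).

Definition vol_normal (k : 'I_(Ne T)) (z : 'I_n.+2) (i : 'I_(Nq X)) :
  'rV[R]_n.+1 := nhat X z *m metric k (vnode i).

Definition fac_normal (k : 'I_(Ne T)) (z : 'I_n.+2) (i : 'I_(Nqf X z)) :
  'rV[R]_n.+1 := nhat X z *m metric k (fnode i).

Definition facet_jac (k : 'I_(Ne T)) (z : 'I_n.+2) (i : 'I_(Nqf X z)) : R :=
  enorm (fac_normal k i).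

Definition Jfmx (k : 'I_(Ne T)) (z : 'I_n.+2) : 'M[R]_(Nqf X z) :=
  diag_mx (\row_i facet_jac k i).

Definition unit_normal (k : 'I_(Ne T)) (z : 'I_n.+2) (i : 'I_(Nqf X z)) :
  'rV[R]_n.+1 := (facet_jac k i)^-1 *: fac_normal k i.

Definition avg_metric (k : 'I_(Ne T)) (l m : 'I_n.+1) : 'M[R]_(Nq X) :=
  \matrix_(i, j) (2^-1 * (metric k (vnode i) l m + metric k (vnode j) l m)).

Definition avg_normal (k : 'I_(Ne T)) (z : 'I_n.+2) (m : 'I_n.+1) :
  'M[R]_(Nq X, Nqf X z) :=
  \matrix_(i, j) (2^-1 * (vol_normal k z i + fac_normal k j) 0 m).

(* The metric terms are left unconstrained since arbitrary approximations of
   the adjugate are allowed.  The last field makes the exterior states below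
   well defined: a facet not lying on the boundary of the domain is a facet of
   another element. *)
Record mesh_geometry : Prop := {
  Omega_open : open (Omega T);
  Omega_connected : connected (Omega T);
  Omega_nonempty : Omega T !=set0;
  mapX_poly : forall k, exists r,
    forall m, polyfun r (fun x => mapX (m:=T) k x 0 m);
  mapX_inj : forall k, set_inj (ref_elem X) (mapX (m:=T) k);
  elems_cover : closure (Omega T) = \bigcup_k elem k;
  elems_nonoverlapping : forall k nu : 'I_(Ne T), k != nu ->
    interior (elem k) `&` interior (elem nu) = set0;
  jacdet_exact_or_interpolated : forall k : 'I_(Ne T),
    exact_jacdet k \/ interpolated_jacdet k;
  facet_jac_neq0 : forall (k : 'I_(Ne T)) z (i : 'I_(Nqf X z)),
    facet_jac k i != 0;
  facets_shared_or_boundary : forall (k : 'I_(Ne T)) z,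
    on_domain_boundary k z \/
    exists nu eta, nu != k /\ efacet k z = efacet nu eta }.

Definition node_match (k : 'I_(Ne T)) (z : 'I_n.+2) (i : 'I_(Nqf X z))
    (nu : 'I_(Ne T)) (eta : 'I_n.+2) (j : 'I_(Nqf X eta)) : Prop :=
  unit_normal k i = - unit_normal nu j /\
  fweight i * facet_jac k i = fweight j * facet_jac nu j.

Definition conforming : Prop :=
  forall k nu : 'I_(Ne T), k != nu ->
    elem_boundary k `&` elem_boundary nu !=set0 ->
    (exists! ze : 'I_n.+2 * 'I_n.+2, efacet k ze.1 = efacet nu ze.2) /\
    (forall z eta, efacet k z = efacet nu eta ->
       forall i : 'I_(Nqf X z), exists! j : 'I_(Nqf X eta),
         node_match k i nu j).

End Geometry.

(* All maps are total; only their values at admissible states (elements of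
   [adm]), and for [entropy], [flux] and [entropy_flux] their derivatives
   there, are ever used. *)
Record conservation_law (R : realType) (n Nc : nat) := ConservationLaw {
  adm : set 'rV[R]_Nc;
  flux : 'I_n.+1 -> 'rV[R]_Nc -> 'rV[R]_Nc;
  entropy : 'rV[R]_Nc -> R;
  entropy_flux : 'I_n.+1 -> 'rV[R]_Nc -> R;
  cons_of : 'rV[R]_Nc -> 'rV[R]_Nc;
  flux2 : 'I_n.+1 -> 'rV[R]_Nc -> 'rV[R]_Nc -> 'rV[R]_Nc;
  num_flux : 'rV[R]_Nc -> 'rV[R]_Nc -> 'rV[R]_n.+1 -> 'rV[R]_Nc }.

Section ConservationLaw.
Context {R : realType} {n Nc : nat} (L : conservation_law R n Nc).

Definition ent_of (u : 'rV[R]_Nc) : 'rV[R]_Nc :=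
  \row_e partial e (entropy L) u.

Definition entropy_hessian (u : 'rV[R]_Nc) : 'M[R]_Nc :=
  \matrix_(i, j) partial i (fun v => ent_of v 0 j) u.

Definition adm_ent : set 'rV[R]_Nc := ent_of @` adm L.

Record entropy_structure : Prop := {
  flux_differentiable : forall m u, adm L u -> differentiable (flux L m) u;
  entropy_differentiable : forall u, adm L u -> differentiable (entropy L) u;
  ent_of_differentiable : forall u, adm L u -> differentiable ent_of u;
  entropy_flux_differentiable : forall m u, adm L u ->
    differentiable (entropy_flux L m) u;
  entropy_hessian_posdef : forall u, adm L u -> posdef (entropy_hessian u);
  entropy_flux_compatible : forall m u, adm L u -> forall j,
    partial j (entropy_flux L m) u =
    \sum_i ent_of u 0 i * partial j (fun v => flux L m v 0 i) u;
  cons_ofK : forall u, adm L u -> cons_of L (ent_of u) = u }.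

Definition flux2_symmetric : Prop :=
  forall m u v, adm L u -> adm L v -> flux2 L m u v = flux2 L m v u.

Definition flux2_consistent : Prop :=
  forall m u, adm L u -> flux2 L m u u = flux L m u.

Definition num_flux_consistent : Prop :=
  forall u nrm, adm L u -> enorm nrm = 1 ->
    num_flux L u u nrm = \sum_m nrm 0 m *: flux L m u.

Definition num_flux_conservative : Prop :=
  forall u v nrm, adm L u -> adm L v -> enorm nrm = 1 ->
    num_flux L u v nrm = - num_flux L v u (- nrm).

End ConservationLaw.

Section Scheme.
Context {R : realType} {n Nc : nat}.
Variables (X : reference R n) (T : mesh R n) (L : conservation_law R n Nc).

Definition modal_state := 'I_(Ne T) -> 'I_Nc -> 'cV[R]_(Np X).
Definition facet_state := 'I_(Ne T) -> forall z, 'I_(Nqf X z) -> 'rV[R]_Nc.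

(* The inverse of the weight-adjusted mass matrix. *)
Definition wadj_mass_inv (k : 'I_(Ne T)) : 'M[R]_(Np X) :=
  invmx (Mmx X) *m (Vmx X)^T *m Wmx X *m invmx (Jmx X k)
    *m Vmx X *m invmx (Mmx X).

(* [c] is the modal solution and [wext] the exterior entropy variables, at a
   given time. *)
Variables (c : modal_state) (wext : facet_state).

Definition nodal_sol (k : 'I_(Ne T)) (e : 'I_Nc) : 'cV[R]_(Nq X) :=
  Vmx X *m c k e.

Definition u_at (k : 'I_(Ne T)) (i : 'I_(Nq X)) : 'rV[R]_Nc :=
  \row_e nodal_sol k e i 0.

Definition nodal_ent (k : 'I_(Ne T)) (e : 'I_Nc) : 'cV[R]_(Nq X) :=
  Vmx X *m (wadj_mass_inv k *m (Vmx X)^T *m Wmx X *m Jmx X k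
              *m \col_i ent_of L (u_at k i) 0 e).

Definition w_at (k : 'I_(Ne T)) (i : 'I_(Nq X)) : 'rV[R]_Nc :=
  \row_e nodal_ent k e i 0.

Definition wf_at (k : 'I_(Ne T)) (z : 'I_n.+2) (i : 'I_(Nqf X z)) :
  'rV[R]_Nc := \row_e (Rmx X z *m nodal_ent k e) i 0.

Record admissible_state : Prop := {
  u_admissible : forall k i, adm L (u_at k i);
  w_admissible : forall k i, adm_ent L (w_at k i);
  wf_admissible : forall k z (i : 'I_(Nqf X z)), adm_ent L (wf_at k i);
  wext_admissible : forall k z (i : 'I_(Nqf X z)), adm_ent L (wext k i) }.

(* On facets lying on the boundary of the domain [wext] is arbitrary boundary
   data. *)
Definition exterior_coupling : Prop :=
  forall (k nu : 'I_(Ne T)) z eta, k != nu ->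
    efacet X k z = efacet X nu eta -> ~ on_domain_boundary X k z ->
    forall (i : 'I_(Nqf X z)) (j : 'I_(Nqf X eta)),
      node_match k i nu j -> wext k i = wf_at nu j.

Definition Fvol (k : 'I_(Ne T)) (m : 'I_n.+1) (e : 'I_Nc) : 'M[R]_(Nq X) :=
  \matrix_(i, j) flux2 L m (cons_of L (w_at k i)) (cons_of L (w_at k j)) 0 e.

Definition Ffac (k : 'I_(Ne T)) (z : 'I_n.+2) (m : 'I_n.+1) (e : 'I_Nc) :
  'M[R]_(Nq X, Nqf X z) :=
  \matrix_(i, j)
    flux2 L m (cons_of L (w_at k i)) (cons_of L (wf_at k j)) 0 e.

Definition fstar (k : 'I_(Ne T)) (z : 'I_n.+2) (e : 'I_Nc) :
  'cV[R]_(Nqf X z) :=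
  \col_i num_flux L (cons_of L (wf_at k i)) (cons_of L (wext k i))
           (unit_normal k i) 0 e.

Definition Cmx (k : 'I_(Ne T)) (z : 'I_n.+2) (e : 'I_Nc) :
  'M[R]_(Nq X, Nqf X z) :=
  hadamard ((Rmx X z)^T *m Bmx X z)
    (\sum_m hadamard (avg_normal X k z m) (Ffac k z m e)).

Definition rhs (k : 'I_(Ne T)) (e : 'I_Nc) : 'cV[R]_(Nq X) :=
  - (\sum_l hadamard (2 *: Smx X l)
        (\sum_m hadamard (avg_metric X k l m) (Fvol k m e)) *m ones (Nq X))
  - \sum_z (Cmx k z e *m ones (Nqf X z)
      + (Rmx X z)^T *m (Bmx X z *m Jfmx X k z *m fstar k z e
                          - (Cmx k z e)^T *m ones (Nq X))).

Definition element_total (k : 'I_(Ne T)) (e : 'I_Nc) : R :=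
  ((ones (Nq X))^T *m Wmx X *m Jmx X k *m nodal_sol k e) 0 0.

Definition facet_outflow (k : 'I_(Ne T)) (z : 'I_n.+2) (e : 'I_Nc) : R :=
  ((ones (Nqf X z))^T *m Bmx X z *m Jfmx X k z *m fstar k z e) 0 0.

End Scheme.

(* Main.v *)
Require Import Defs.
From HB Require Import structures.
From mathcomp Require Import all_boot all_order all_algebra.
From mathcomp Require Import all_classical all_reals all_analysis.
From mathcomp Require Import (canonicals, coercions) mpoly.
From mathcomp Require Import ring lra.

(** On one element, degree at most [p] of the Jacobian determinant makes
    [1^T W J] invariant under the L2 projection, so that the weight-adjusted
    mass matrix cancels and the total changes at the rate [1^T r].  The volume
    terms of [1^T r] vanish as contractions of skew-symmetric with symmetric
    matrices, and [R 1 = 1] cancels the facet corrections, leaving minus the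
    facet outflows.

    For two distinct elements sharing a facet, the node matching is a bijection
    and the outflows are opposite.  That a facet has only two sides is not
    needed: on a class of at least two coincident facets whose outflows are
    pairwise opposite, the outflows sum to zero in any case. *)

Set Implicit Arguments.
Unset Strict Implicit.
Unset Printing Implicit Defensive.
Import Order.TTheory GRing.Theory Num.Theory numFieldNormedType.Exports.
Local Open Scope classical_set_scope.
Local Open Scope ring_scope.

(** * Derivatives, antisymmetric sums and skew contractions *)

Lemma is_derive_mulmx_entry (R : realType) (m : nat) (A : 'rV[R]_m)
    (f : R -> 'cV[R]_m) (t : R) (df : 'cV[R]_m) :
  is_derive t (1 : R) f df ->
  is_derive t (1 : R) (fun s => (A *m f s) 0 0) ((A *m df) 0 0).
Proof.
case=> fd fE.
have fdj j : is_derive t (1 : R) (fun s => f s j 0) (df j 0).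
  apply: DeriveDef; first exact: (derivable_mxP _ _ _).1.
  by rewrite -fE derive_mx // mxE.
have -> : (fun s => (A *m f s) 0 0) = \sum_(j < m) (A 0 j *: fun s => f s j 0).
  by apply/funext => s; rewrite fct_sumE mxE.
by rewrite mxE; apply: is_derive_sum => j; apply: is_deriveZ.
Qed.

(* Averaging over the set of the other members of a class, whose size is
   constant on the class, makes the sum equal to its own opposite. *)
Lemma sum_class_antisym_eq0 (K : numFieldType) (I : finType) (P : pred I)
    (r : rel I) (a : I -> K) :
  symmetric r -> transitive r ->
  (forall x, P x -> exists2 y, P y & (x != y) && r x y) ->
  (forall x y, P x -> P y -> x != y -> r x y -> a x = - a y) ->
  \sum_(x | P x) a x = 0.
Proof.
move=> rC rT ex_partner a_anti.
pose other x y := [&& P y, x != y & r x y].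
pose N x : K := #|[pred y | other x y]|%:R.
have N_neq0 x : P x -> N x != 0.
  move=> Px; have [y Py xy] := ex_partner x Px.
  by rewrite pnatr_eq0 -lt0n; apply/card_gt0P; exists y; rewrite inE /other Py.
have rr x : P x -> r x x.
  move=> Px; have [y _ /andP[_ rxy]] := ex_partner x Px.
  by apply: (rT y) => //; rewrite rC.
have N_class x y : P x -> P y -> r x y -> N x = N y.
  move=> Px Py rxy.
  (* The whole class, [z] included, has one element more than [other z]. *)
  have card_other z : P z ->
      #|[pred w | P w && r z w]| = (#|[pred w | other z w]|).+1.
    move=> Pz; rewrite (cardD1 z) inE Pz rr //= add1n; congr _.+1.
    by apply: eq_card => w; rewrite !inE /other eq_sym andbCA.
  congr _%:R; apply: succn_inj; rewrite -!card_other //.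
  apply: eq_card => w; rewrite !inE; congr (_ && _).
  by apply/idP/idP; apply: rT; rewrite // rC.
set S := LHS.
have S_avg : S = \sum_(x | P x) \sum_(y | other x y) (N x)^-1 * a x.
  apply: eq_bigr => x Px.
  by rewrite sumr_const -mulr_natl mulrA divff ?mul1r ?N_neq0.
(* Exchanging the two sums swaps the roles of [x] and [y]; [N] agrees on them and [a] changes
   sign. *)
have SN : S = - S.
  rewrite {1}S_avg.
  rewrite (exchange_big_dep P) /=; last by move=> x y _ /and3P[].
  rewrite S_avg -sumrN; apply: eq_bigr => y Py; rewrite -sumrN.
  apply: eq_big => [x | x /andP[Px /and3P[_ xy rxy]]].
    by rewrite /other Py eq_sym rC.
  by rewrite /= (N_class x y) // (a_anti x y) // mulrN.
have : S *+ 2 == 0 by rewrite mulr2n {2}SN subrr.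
by rewrite mulrn_eq0 => /eqP.
Qed.

(** The Hadamard product is again skew-symmetric, and a 1-by-1 matrix equal to minus its transpose
    is zero. *)
Lemma hadamard_skew_sym (R : realType) (m : nat) (A F : 'M[R]_m) :
  A^T = - A -> F^T = F -> (ones m)^T *m (hadamard A F *m ones m) = 0.
Proof.
move=> skewA symF; set v := LHS.
have AF : (hadamard A F)^T = - hadamard A F.
  apply/matrixP => i j.
  move/matrixP: skewA => /(_ i j); move/matrixP: symF => /(_ i j).
  by rewrite !mxE => -> ->; rewrite mulNr.
have vT : v^T = - v.
  by rewrite !trmx_mul AF trmxK mulmxN mulNmx -mulmxA.
have v00 : v 0 0 = - v 0 0 by move/matrixP: vT => /(_ 0 0); rewrite [LHS]mxE [RHS]mxE.
apply/matrixP => i j; rewrite !ord1 [RHS]mxE; lra.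
Qed.

Lemma polyfun1 (R : realType) (d k : nat) : polyfun k (fun _ : 'rV[R]_d => 1).
Proof.
exists 1; first by rewrite mpoly.msize1.
by move=> x; rewrite mpoly.meval1.
Qed.

(** * Projection and extrapolation on one element *)

Section Element.
Variables (R : realType) (n : nat) (X : reference R n).

Lemma nodal1 : nodal X (fun=> 1) = ones (Nq X).
Proof. by apply/matrixP => i j; rewrite !mxE. Qed.

Lemma Rmx_ones (p q : nat) (z : 'I_n.+2) :
  sbp_operators X p q -> Rmx X z *m ones (Nq X) = ones (Nqf X z).
Proof.
move=> /Rmx_exact /(_ z)[r _ /(_ _ (polyfun1 _ _ _))].
by rewrite nodal1 => ->; apply/matrixP => i j; rewrite !mxE.
Qed.

Lemma Smx_skew (p q : nat) (l : 'I_n.+1) :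
  sbp_operators X p q -> (Smx X l)^T = - Smx X l.
Proof.
move=> /Qmx_sbp /(_ l) QE; rewrite /Smx -QE; apply/matrixP => i j.
rewrite !mxE; lra.
Qed.

(** [V M^-1 V^T W] is the [W]-orthogonal projection onto the range of [V], which contains the nodal
    values of [f]. *)
Lemma modal_projection (p : nat) (f : 'rV[R]_n.+1 -> R) :
  modal_basis X p -> polyfun p f ->
  Vmx X *m invmx (Mmx X) *m (Vmx X)^T *m Wmx X *m nodal X f = nodal X f.
Proof.
move=> [_ basis Munit] /basis[c [cE _]].
have -> : nodal X f = Vmx X *m c.
  apply/matrixP => i j; rewrite ord1 !mxE cE.
  by apply: eq_bigr => k _; rewrite mxE mulrC.
by rewrite -!mulmxA [X in _ *m (_ *m X)]mulmxA
  [X in _ *m (_ *m X)]mulmxA -/(Mmx X) mulKmx.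
Qed.

(** Transposed form, by the symmetry of [W] and hence of [M]. *)
Lemma modal_projection_tr (p q : nat) (f : 'rV[R]_n.+1 -> R) :
  sbp_operators X p q -> modal_basis X p -> polyfun p f ->
  (nodal X f)^T *m Wmx X *m Vmx X *m invmx (Mmx X) *m (Vmx X)^T
    = (nodal X f)^T.
Proof.
move=> /Wmx_posdef[WT _] hbasis pf.
rewrite -[in RHS](modal_projection hbasis pf) !trmx_mul trmxK trmx_inv.
have -> : (Mmx X)^T = Mmx X by rewrite /Mmx !trmx_mul trmxK WT mulmxA.
by rewrite WT !mulmxA.
Qed.

Variable T : mesh R n.

(* [1^T W J] is the transpose of [W] applied to the nodal values of the
   polynomial [jacdet k], hence is preserved by the L2 projection; this is
   where the degree bound on the Jacobian determinant enters. *)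
Lemma ones_wadj (p q : nat) (k : 'I_(Ne T)) :
  sbp_operators X p q -> modal_basis X p -> is_diag_mx (Wmx X) ->
  (forall i : 'I_(Nq X), jacdet k (vnode i) != 0) -> polyfun p (jacdet k) ->
  (ones (Nq X))^T *m Wmx X *m Jmx X k *m Vmx X
    *m (wadj_mass_inv X k *m (Vmx X)^T) = (ones (Nq X))^T.
Proof.
move=> hsbp hbasis /diag_mxP[w Ww] J_neq0 Jpoly.
(* Diagonal [W] and [J] commute, so [J] can meet the ones first. *)
have WJ : (ones (Nq X))^T *m Wmx X *m Jmx X k
    = (nodal X (jacdet k))^T *m Wmx X.
  rewrite -mulmxA Ww diag_mxC mulmxA; congr (_ *m _).
  apply/matrixP => i j; rewrite mul_mx_diag !mxE mul1r //.
have Junit : Jmx X k \in unitmx.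
  rewrite unitmxE det_diag unitfE; apply/prodf_neq0 => i _.
  by rewrite mxE.
(* The projection acts twice: on the Jacobian determinant and, once [J] has cancelled its inverse,
   on the constant 1. *)
rewrite /wadj_mass_inv !mulmxA WJ (modal_projection_tr hsbp hbasis) //.
rewrite -WJ mulmxK // -nodal1 (modal_projection_tr hsbp hbasis) //.
exact: polyfun1.
Qed.

End Element.

(** * Facet outflows and their cancellation *)

Section Outflow.
Variables (R : realType) (n Nc : nat).
Variables (X : reference R n) (T : mesh R n) (L : conservation_law R n Nc).
Variables (c : @modal_state R n Nc X T) (wext : @facet_state R n Nc X T).

Lemma cons_of_adm w : entropy_structure L -> adm_ent L w -> adm L (cons_of L w).
Proof. by move=> /cons_ofK consK [u Lu <-]; rewrite consK. Qed.

Lemma ones_rhs (p q : nat) k e :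
  sbp_operators X p q -> entropy_structure L -> flux2_symmetric L ->
  admissible_state L c wext ->
  ((ones (Nq X))^T *m rhs L c wext k e) 0 0
    = - \sum_z facet_outflow L c wext k z e.
Proof.
move=> hsbp hL hsym [_ w_adm _ _].
rewrite /rhs mulmxBr mulmxN !mulmx_sumr big1 => [|l _]; last first.
  apply: hadamard_skew_sym.
    by rewrite linearZ /= (Smx_skew _ hsbp) scalerN.
  rewrite linear_sum /=; apply: eq_bigr => m _; apply/matrixP => i j.
  rewrite !mxE addrC hsym //; exact: cons_of_adm.
rewrite oppr0 add0r [LHS]mxE summxE; congr (- _); apply: eq_bigr => z _.
(* With [R 1 = 1] the correction contributes [- 1^T C^T 1]; as a scalar this is [- 1^T C 1], which
   cancels the first term. *)
rewrite (mulmxDr (ones _)^T) (mulmxA _ (Rmx X z)^T) -trmx_mul (Rmx_ones _ hsbp) mulmxBr.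
have -> : (ones (Nqf X z))^T *m ((Cmx L c k z e)^T *m ones (Nq X))
    = (ones (Nq X))^T *m Cmx L c k z e *m ones (Nqf X z).
  set x := RHS; rewrite mulmxA.
  have -> : x = x^T by apply/matrixP => i j; rewrite !ord1 [RHS]mxE.
  by rewrite !trmx_mul trmxK mulmxA.
by rewrite mulmxA addrC subrK !mulmxA.
Qed.

Lemma facet_outflowE k z e :
  facet_outflow L c wext k z e
    = \sum_i fweight i * facet_jac k i * fstar L c wext k z e i 0.
Proof.
rewrite /facet_outflow mxE; apply: eq_bigr => i _; congr (_ * _).
by rewrite !mul_mx_diag !mxE mul1r.
Qed.

(** Conservativity of the numerical flux is assumed for unit normals only. *)
Lemma enorm_unit_normal k z (i : 'I_(Nqf X z)) :
  facet_jac (T:=T) k i != 0 -> enorm (unit_normal k i) = 1.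
Proof.
move=> J_neq0; rewrite /enorm /unit_normal.
have -> : dot ((facet_jac k i)^-1 *: fac_normal k i)
    ((facet_jac k i)^-1 *: fac_normal k i)
    = (facet_jac k i)^-1 ^+ 2 * dot (fac_normal k i) (fac_normal k i).
  by rewrite /dot mulr_sumr; apply: eq_bigr => m _; rewrite !mxE; ring.
rewrite sqrtrM ?sqr_ge0 // sqrtr_sqr -/(enorm _) -/(facet_jac k i).
by rewrite ger0_norm ?mulVf // invr_ge0 sqrtr_ge0.
Qed.

Lemma node_match_sym (k nu : 'I_(Ne T)) z eta
    (i : 'I_(Nqf X z)) (j : 'I_(Nqf X eta)) :
  node_match k i nu j -> node_match nu j k i.
Proof. by case=> nE wE; split; [rewrite nE opprK | rewrite wE]. Qed.

Lemma efacet_nonempty (k : 'I_(Ne T)) z : efacet X k z !=set0.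
Proof.
(* Any vertex other than the [z]-th lies on the facet opposite to it. *)
exists (mapX k (vertex X (lift z ord0))); exists (vertex X (lift z ord0)) => //.
exists (fun i => (i == lift z ord0)%:R); split.
- by move=> i; rewrite ler0n.
- by rewrite (bigD1 (lift z ord0)) //= eqxx big1 ?addr0 // => i /negbTE->.
- by rewrite (negbTE (neq_lift _ _)).
- rewrite (bigD1 (lift z ord0)) //= eqxx scale1r big1 ?addr0 //.
  by move=> i /negbTE->; rewrite scale0r.
Qed.

Section SharedFacet.
Variables (k nu : 'I_(Ne T)) (z eta : 'I_n.+2).
Hypotheses (hconf : conforming X T) (kNnu : k != nu).
Hypothesis shared : efacet X k z = efacet X nu eta.

(** Conformity only concerns elements whose boundaries meet. *)
Lemma elem_boundary_meet : elem_boundary X k `&` elem_boundary X nu !=set0.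
Proof.
have [x kzx] := efacet_nonempty k z.
by exists x; split; [exists z | exists eta => //; rewrite -shared].
Qed.

Lemma shared_facet_match (i : 'I_(Nqf X z)) :
  exists! j : 'I_(Nqf X eta), node_match k i nu j.
Proof. by have [_] := hconf kNnu elem_boundary_meet; apply. Qed.

End SharedFacet.

Lemma shared_facet_outflow (k nu : 'I_(Ne T)) z eta e :
  mesh_geometry X T -> conforming X T -> entropy_structure L ->
  num_flux_conservative L ->
  admissible_state L c wext -> exterior_coupling L c wext ->
  k != nu -> efacet X k z = efacet X nu eta -> ~ on_domain_boundary X k z ->
  facet_outflow L c wext k z e = - facet_outflow L c wext nu eta e.
Proof.
move=> hT hconf hL hconserv [_ _ wf_adm _] coupled kNnu shared k_int.
have nu_int : ~ on_domain_boundary X nu eta.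
  by rewrite /on_domain_boundary -shared.
have nuNk : nu != k by rewrite eq_sym.
pose m i j := `[< node_match (X:=X) k (z:=z) i nu (eta:=eta) j >].
rewrite !facet_outflowE -sumrN.
(* The outflow becomes a sum over matched node pairs: each [i] has exactly one [j] and, after the
   exchange, each [j] exactly one [i]. *)
transitivity (\sum_i \sum_(j | m i j)
    fweight i * facet_jac k i * fstar L c wext k z e i 0).
  apply: eq_bigr => i _.
  have [j [mij j_uniq]] := shared_facet_match hconf kNnu shared i.
  rewrite (big_pred1 j) // => j' /=.
  by apply/asboolP/eqP => [/j_uniq|->].
rewrite (exchange_big_dep predT) //=; apply: eq_bigr => j _.
have [i [mji i_uniq]] := shared_facet_match hconf nuNk (esym shared) j.
rewrite (big_pred1 i) => [|i' /=]; last first.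
  by apply/asboolP/eqP => [/node_match_sym/i_uniq|->] //; exact: node_match_sym.
have mij := node_match_sym mji.
have [nE wE] := mij.
rewrite wE -mulrN; congr (_ * _); rewrite !mxE.
(* The exterior state on each side is the facet state of the other, so the two fluxes have swapped
   arguments and opposite normals. *)
rewrite (coupled _ _ _ _ kNnu shared k_int _ _ mij).
rewrite (coupled _ _ _ _ nuNk (esym shared) nu_int _ _ mji).
rewrite hconserv; last first.
- exact/enorm_unit_normal/(facet_jac_neq0 hT).
- exact: cons_of_adm.
- exact: cons_of_adm.
by rewrite nE opprK mxE.
Qed.

Lemma interior_outflow_eq0 e :
  mesh_geometry X T -> conforming X T -> entropy_structure L ->
  num_flux_conservative L ->
  admissible_state L c wext -> exterior_coupling L c wext ->
  \sum_(k < Ne T) \sum_(z | ~~ `[< on_domain_boundary X k z >])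
    facet_outflow L c wext k z e = 0.
Proof.
move=> hT hconf hL hconserv hadm hext.
rewrite pair_big_dep /=.
apply: (sum_class_antisym_eq0
  (r := fun x y => `[< efacet X x.1 x.2 = efacet X y.1 y.2 >])).
- by move=> x y; apply/asboolP/asboolP.
- by move=> y x w /asboolP xy /asboolP yw; apply/asboolP; rewrite xy.
- move=> [k z] /= /asboolP k_int.
  have [//|[nu [eta [nuNk shared]]]] := facets_shared_or_boundary hT k z.
  exists (nu, eta) => /=.
    by apply/asboolP; rewrite /on_domain_boundary -shared.
  apply/andP; split; last exact/asboolP.
  by apply/eqP => -[kE _]; rewrite kE eqxx in nuNk.
move=> [k z] [nu eta] /= /asboolP k_int _ xNy /asboolP shared.
have [kE|kNnu] := eqVneq k nu; last exact: shared_facet_outflow.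
(* One element cannot meet itself along two facets: both would be matched with
   the same facet of a neighbour. *)
have [//|[mu [theta [muNk kmu]]]] := facets_shared_or_boundary hT k z.
rewrite eq_sym in muNk; subst nu.
have [[ze [_ uniq_ze]] _] := hconf _ _ muNk (elem_boundary_meet kmu).
have := etrans (esym (uniq_ze (z, theta) kmu))
  (uniq_ze (eta, theta) (etrans (esym shared) kmu)).
by case=> zE; rewrite zE eqxx in xNy.
Qed.

End Outflow.

Theorem theorem2 (R : realType) (n : nat) (hd : n.+1 = 2%N \/ n.+1 = 3%N)
  (Nc p q tau : nat) (hpq : (p <= q)%N) (htau : (2 * p <= tau)%N)
  (X : reference R n) (T : mesh R n) (L : conservation_law R n Nc)
  (* standing assumptions *)
  (hX : reference_element X) (hsbp : sbp_operators X p q)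
  (hbasis : modal_basis X p) (hT : mesh_geometry X T)
  (hL : entropy_structure L)
  (* (i) *)
  (hdiag : is_diag_mx (Wmx X)) (hE : E_decomposition X)
  (hJpos : forall (k : 'I_(Ne T)) x, ref_elem X x -> 0 < jacdet k x)
  (hsym : flux2_symmetric L) (hcons2 : flux2_consistent L)
  (hcons : num_flux_consistent L) (hconserv : num_flux_conservative L)
  (* (ii) *)
  (hconf : conforming X T)
  (* (iii) *)
  (hJpoly : forall k : 'I_(Ne T), polyfun p (jacdet k))
  (hquad : quadrature_exact X tau)
  (* a solution of the semi-discrete scheme on a set of times *)
  (times : set R)
  (ut : 'I_(Ne T) -> 'I_Nc -> R -> 'cV[R]_(Np X))
  (wext : R -> @facet_state R n Nc X T)
  (hadm : forall t, times t ->
     admissible_state L (fun k e => ut k e t) (wext t))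
  (hext : forall t, times t ->
     exterior_coupling L (fun k e => ut k e t) (wext t))
  (hode : forall t, times t -> forall k e,
     is_derive t (1 : R) (ut k e)
       (wadj_mass_inv X k *m (Vmx X)^T
          *m rhs L (fun k' e' => ut k' e' t) (wext t) k e)) :
  forall t, times t -> forall e : 'I_Nc,
    is_derive t (1 : R)
      (fun s : R => \sum_(k < Ne T)
         element_total (fun k' e' => ut k' e' s) k e)
      (- \sum_(k < Ne T) \sum_(z < n.+2 | `[< on_domain_boundary X k z >])
           facet_outflow L (fun k' e' => ut k' e' t) (wext t) k z e).
Proof.
move=> t t_in e.
set outflow := facet_outflow L (fun k e => ut k e t) (wext t).
(* Interior outflows add up to zero, so the sum may run over all facets. *)
have -> : - \sum_(k < Ne T) \sum_(z < n.+2 | `[< on_domain_boundary X k z >])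
    outflow k z e = \sum_(k < Ne T) - \sum_z outflow k z e.
  rewrite sumrN; congr (- _); apply/eqP; rewrite -subr_eq0 -opprB oppr_eq0.
  rewrite -sumrB; apply/eqP.
  rewrite -[RHS](interior_outflow_eq0 e hT hconf hL hconserv
    (hadm t t_in) (hext t t_in)).
  apply: eq_bigr => k _.
  by rewrite (bigID (fun z => `[< on_domain_boundary X k z >])) /= addrC addrK.
rewrite (_ : (fun s => _) = \sum_(k < Ne T)
    fun s => element_total (fun k' e' => ut k' e' s) k e); last first.
  by apply/funext => s; rewrite fct_sumE.
apply: is_derive_sum => k.
rewrite -(ones_rhs k e hsbp hL hsym (hadm t t_in)).
(* Read backwards, this turns [1^T] into the row [1^T W J V] times the operator that the scheme
   applies to [rhs]. *)
rewrite -(ones_wadj hsbp hbasis hdiag _ (hJpoly k)); last first.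
  by move=> i; rewrite gt_eqF // hJpos //; exact: vnode_in hX i.
rewrite -!mulmxA.
have := is_derive_mulmx_entry ((ones (Nq X))^T *m Wmx X *m Jmx X k *m Vmx X)
  (hode t t_in k e).
rewrite -!mulmxA; congr is_derive; apply/funext => s.
by rewrite /element_total /nodal_sol !mulmxA.
Qed.
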